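(* Let $G$ be a graph of order $n=4k+1$, where $k\ge 0$ is an integer. If the Seidel matrix $S$ of $G$ is singular and $\phi(S)\in\{\pm 1\}^n$, then $$3k\le |E(G)|\le 8k^2-k.$$ Moreover, both bounds are tight: for every natural number $k$ there is a graph of order $n=4k+1$ with singular Seidel matrix $S$ and $\phi(S)\in\{\pm1\}^n$ having exactly $3k$ edges, and there is such a graph having exactly $8k^2-k$ edges.
   Context: All graphs are simple, undirected, finite, with at least one vertex. The order of a graph is its number of vertices; $E(G)$ is the edge set of $G$. For a graph $G$ with vertices $v_1,\dots,v_n$ and adjacency matrix $A$, the Seidel matrix of $G$ is $S=J_n-I_n-2A$, where $J_n$ is the all-ones $n\times n$ matrix and $I_n$ the identity. It is known that $\operatorname{rank} S\ge n-1$ always. Hence, when $S$ is singular, its nullspace is one-dimensional, and $\phi(S)$ denotes the unique integer vector $\phi\in\mathbb{Z}^n$ with $S\phi=0$, with the greatest common divisor of its entries equal to $1$, and with first non-zero entry positive. *)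

(* Defs.v *)
From HB Require Import structures.
From mathcomp Require Import all_boot all_order all_algebra.

Set Implicit Arguments.
Unset Strict Implicit.
Unset Printing Implicit Defensive.

Import Order.TTheory GRing.Theory Num.Theory.

Local Open Scope ring_scope.

Record sgraph (n : nat) := SGraph {
  adj : rel 'I_n;
  adj_sym : symmetric adj;
  adj_irr : irreflexive adj
}.

Definition edges (n : nat) (G : sgraph n) : {set {set 'I_n}} :=
  [set [set x; y] | x in 'I_n, y in adj G x].

Definition adjmx (n : nat) (G : sgraph n) : 'M[int]_n :=
  \matrix_(i, j) (adj G i j)%:R.

Definition seidel (n : nat) (G : sgraph n) : 'M[int]_n :=
  const_mx 1 - 1%:M - 2 *: adjmx G.

(* Over [int], [unitmx] means determinant +1 or -1, so singularity must be
   stated with the determinant. *)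
Definition singular (n : nat) (S : 'M[int]_n) : Prop := \det S = 0.

(* [is_phi S v] says that [v] is phi(S). When [S] is a singular Seidel matrix,
   its rank is [n - 1] and exactly one [v] satisfies this. *)
Definition is_phi (n : nat) (S : 'M[int]_n) (v : 'cV[int]_n) : Prop :=
  [/\ S *m v = 0,
      \big[gcdz/0]_(i < n) v i 0 = 1
    & forall i : 'I_n, v i 0 != 0 ->
        (forall j : 'I_n, (j < i)%N -> v j 0 = 0) -> 0 < v i 0].

Definition pm1 (n : nat) (v : 'cV[int]_n) : Prop :=
  forall i : 'I_n, v i 0 = 1 \/ v i 0 = -1.

Definition singular_pm1 (n : nat) (G : sgraph n) : Prop :=
  singular (seidel G) /\ exists2 v, is_phi (seidel G) v & pm1 v.

(* Main.v *)
(** Put [A] for the adjacency matrix, [v] for a sign vector killed by the Seidel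
    matrix [S], and [s] for the sum of its entries. The row equations of [S]
    read [2 * (A v)_i = s - v_i]; they make [s] odd, and up to replacing [v] by
    [- v] one has [1 <= s <= n]. As [A] is nonnegative,
    [0 <= 2 * \sum_(i, j) A_ij (1 - v_i) (1 - v_j)
        = 4 |E| - 2 * (n - 1) * s + s^2 - n],
    which for [n = 4k + 1] is [4 |E| >= 12 k + (s - 1) (8k - 1 - s)], hence
    [|E| >= 3k]. The complement of the graph has Seidel matrix [- S], so the
    upper bound and its tightness follow from the lower ones. The lower bound
    is attained by the disjoint union of [k] paths on four vertices and one
    isolated vertex, with [v = 1] on the inner vertices of the paths and on the
    isolated vertex, and [v = -1] on the ends. *)

Require Import Defs.
From mathcomp Require Import all_boot all_order all_algebra.
From mathcomp Require Import zify ring lra.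

Set Implicit Arguments.
Unset Strict Implicit.
Unset Printing Implicit Defensive.

Import Order.TTheory GRing.Theory Num.Theory.

(** * Seidel matrices, edge counting and complements *)

Section Seidel.

Local Open Scope ring_scope.

Variables (n : nat) (G : sgraph n).

Lemma mul_seidelE (v : 'cV[int]_n) i :
  (seidel G *m v) i 0 =
    \sum_j v j 0 - v i 0 - 2 * \sum_(j | adj G i j) v j 0.
Proof.
rewrite mxE (eq_bigr (fun j => v j 0 - (if j == i then v j 0 else 0) -
    2 * (if adj G i j then v j 0 else 0))) => [|j _].
  by rewrite !sumrB -mulr_sumr -!big_mkcond /= big_pred1_eq.
rewrite !mxE (eq_sym j i).
by case: (i == j); case: (adj G i j); rewrite /=; ring.
Qed.

(** Handshake: the map from ordered adjacent pairs to edges has fibres [(x, y)], [(y, x)], of size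
    two by irreflexivity. *)
Lemma sum_card_adj : (\sum_i #|adj G i|)%N = (2 * #|edges G|)%N.
Proof.
pose D := [set p : 'I_n * 'I_n | adj G p.1 p.2].
pose f (p : 'I_n * 'I_n) := [set p.1; p.2].
have edgesE : edges G = f @: D.
  apply/setP=> e; apply/imset2P/imsetP => [[x y _ xy ->]|[[x y] xy ->]].
    by exists (x, y); rewrite // inE.
  by exists x y => //; rewrite inE in xy.
have -> : (\sum_i #|adj G i|)%N = (\sum_(p in D) 1)%N.
  rewrite (eq_bigr (fun i => \sum_(j | adj G i j) 1)%N) => [|i _]; last first.
    by rewrite sum1_card.
  by rewrite pair_big_dep; apply: eq_bigl => -[x y]; rewrite inE.
rewrite (partition_big_imset f) /= -edgesE mulnC -sum_nat_const.
apply: eq_bigr => e; rewrite edgesE => /imsetP[[x y]]; rewrite inE /= => xy ->.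
have nxy : (x, y) != (y, x).
  by apply/eqP => -[exy _]; rewrite exy adj_irr in xy.
rewrite sum1_card -(_ : #|[set (x, y); (y, x)]| = 2%N); last by rewrite cards2 nxy.
apply: eq_card => -[a b]; rewrite !inE unfold_in !inE /f /=.
apply/andP/orP => [[ab /eqP/setP eab]|].
  move: (eab a) (eab b); rewrite !inE !eqxx orbT /= => /esym + /esym.
  move=> /orP[]/eqP ea /orP[]/eqP eb; subst a b; rewrite ?eqxx; auto.
    by rewrite adj_irr in ab.
  by rewrite adj_irr in ab.
case=> /eqP[-> ->]; split=> //; first by rewrite adj_sym.
by rewrite setUC.
Qed.

Lemma sum_sum_adj :
  \sum_i \sum_(j | adj G i j) (1 : int) = 2 * #|edges G|%:R.
Proof.
rewrite -natrM -sum_card_adj natr_sum; apply: eq_bigr => i _.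
by rewrite sumr_const.
Qed.

Lemma edges_seidel_ge (v : 'cV[int]_n) (s := \sum_i v i 0) :
    seidel G *m v = 0 -> pm1 v ->
  2 * (n%:R - 1) * s - s ^+ 2 + n%:R <= 4 * #|edges G|%:R.
Proof.
move=> Sv0 v1.
have rowE i : 2 * \sum_(j | adj G i j) v j 0 = s - v i 0.
  by move: (mul_seidelE v i); rewrite Sv0 mxE -/s; lra.
have sqr1 i : v i 0 * v i 0 = 1 by case: (v1 i) => ->.
have : 0 <= \sum_i \sum_(j | adj G i j) 2 * ((1 - v i 0) * (1 - v j 0)).
  apply: sumr_ge0 => i _; apply: sumr_ge0 => j _.
  by case: (v1 i) (v1 j) => -> [] ->.
have -> : \sum_i \sum_(j | adj G i j) 2 * ((1 - v i 0) * (1 - v j 0)) =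
    \sum_i (2 * (\sum_(j | adj G i j) 1) - (s - v i 0) + v i 0 * s - 1)
    - 2 * (\sum_i \sum_(j | adj G i j) v i 0).
  rewrite mulr_sumr -sumrB; apply: eq_bigr => i _.
  transitivity (2 * (\sum_(j | adj G i j) 1)
      - 2 * (\sum_(j | adj G i j) v j 0)
      + v i 0 * (2 * (\sum_(j | adj G i j) v j 0))
      - 2 * \sum_(j | adj G i j) v i 0); last first.
    by rewrite rowE mulrBr sqr1; ring.
  rewrite !mulr_sumr -!sumrB -big_split /= -sumrB.
  by apply: eq_bigr => j _; ring.
(* Swapping the two ends turns this degree-weighted sum into sums of [v] over neighbourhoods, where
   [rowE] applies. *)
have -> : \sum_i \sum_(j | adj G i j) v i 0 =
    \sum_j \sum_(i | adj G j i) v i 0.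
  rewrite (exchange_big_dep xpredT) //=; apply: eq_bigr => j _.
  by apply: eq_bigl => i; rewrite adj_sym.
rewrite mulr_sumr (eq_bigr _ (fun i _ => rowE i)) !sumrB big_split /= !sumrB.
rewrite -mulr_sumr sum_sum_adj -mulr_suml -/s !sumr_const !card_ord.
rewrite -(mulr_natl s n); lra.
Qed.

Lemma compl_sym : symmetric (fun i j => (i != j) && ~~ adj G i j).
Proof. by move=> i j; rewrite eq_sym adj_sym. Qed.

Lemma compl_irr : irreflexive (fun i j => (i != j) && ~~ adj G i j).
Proof. by move=> i; rewrite eqxx. Qed.

Definition compl : sgraph n := SGraph compl_sym compl_irr.

Lemma seidel_compl : seidel compl = - seidel G.
Proof.
apply/matrixP => i j; rewrite !mxE /=.
by case: (eqVneq i j) => [->|_]; rewrite ?adj_irr //; case: (adj G i j).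
Qed.

End Seidel.

(** * The lower bound and passage to the complement *)

Section Bounds.

Local Open Scope ring_scope.

Lemma card_edges_compl n (G : sgraph n) :
  (2 * (#|edges G| + #|edges (compl G)|) = n * n.-1)%N.
Proof.
rewrite mulnDr -!sum_card_adj -big_split /= -[in RHS](card_ord n) -sum_nat_const.
apply: eq_bigr => i _; rewrite -(cardsC1 i) -(cardID (adj G i)).
congr (_ + _)%N; apply: eq_card => j.
  rewrite [in RHS]inE /= in_setC1 andbC; case: (eqVneq j i) => [->|_].
    by rewrite andbF; exact: adj_irr.
  by rewrite andbT.
by rewrite [in RHS]inE /= in_setC1 [LHS]unfold_in andbC eq_sym.
Qed.

Lemma singular_pm1_compl n (G : sgraph n) :
  singular_pm1 G -> singular_pm1 (compl G).
Proof.
case=> detG [v [Sv0 gcd_v sgn_v] v1]; split; last first.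
  by exists v => //; split => //; rewrite seidel_compl mulNmx Sv0 oppr0.
by rewrite /singular seidel_compl -scaleN1r detZ detG mulr0.
Qed.

Lemma edges_ge k (G : sgraph (4 * k + 1)) :
  singular_pm1 G -> (3 * k <= #|edges G|)%N.
Proof.
case=> _ [v [Sv0 _ _] v1].
wlog s_ge0 : v Sv0 v1 / 0 <= \sum_i v i 0.
  move=> hwlog; case: (lerP 0 (\sum_i v i 0)) => [|s_lt0]; first exact: hwlog.
  apply: (hwlog (- v)); first by rewrite mulmxN Sv0 oppr0.
    by move=> i; rewrite mxE; case: (v1 i) => ->; [right|left]; rewrite ?opprK.
  rewrite (eq_bigr (fun i => - v i 0)) => [|i _]; last by rewrite mxE.
  by rewrite sumrN oppr_ge0 ltW.
move: s_ge0; set s := \sum_i v i 0 => s_ge0.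
have s_le : s <= (4 * k + 1)%:R.
  rewrite -[leRHS](_ : \sum_(i < 4 * k + 1) 1 = _); last by rewrite sumr_const card_ord.
  by apply: ler_sum => i _; case: (v1 i) => ->.
(* Any single row equation makes [s] odd. *)
have s_neq0 : s != 0.
  have i0 : 'I_(4 * k + 1) by rewrite addn1; apply: ord0.
  move: (mul_seidelE G v i0); rewrite Sv0 mxE -/s.
  by case: (v1 i0) => ->; lia.
have := edges_seidel_ge Sv0 v1; rewrite -/s.
(* For [k = 0] the second factor is negative, but then [s = 1]; otherwise
   [s <= 4k + 1 <= 8k - 1]. *)
have : 0 <= (s - 1) * (8 * k%:R - 1 - s) :> int.
  clearbody s; clear v Sv0 v1 G; case: k s_le => [|k] s_le.
    by have -> : s = 1 by lia.
  by apply: mulr_ge0; lia.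
rewrite natrD natrM; move: (#|edges G|) => e; nia.
Qed.

(** Multiplying [S v = 0] by the adjugate gives [det S * v = 0], so the entry 1 forces [det S = 0].
    As it comes first, it also settles the gcd and the sign. *)
Lemma singular_pm1_sign n (G : sgraph n) (v : 'cV[int]_n) (i0 : 'I_n) :
    i0 = 0%N :> nat -> v i0 0 = 1 -> pm1 v -> seidel G *m v = 0 ->
  singular_pm1 G.
Proof.
case: n G v i0 => [|n] G v i0 i0E vi0 v1 Sv0; first by case: i0 {i0E vi0}.
have v0 : v ord0 0 = 1 by rewrite -vi0; congr (v _ _); apply: val_inj.
split.
  have := congr1 (mulmx (\adj (seidel G))) Sv0.
  rewrite mulmxA mul_adj_mx mulmx0 mul_scalar_mx => /matrixP/(_ ord0 0).
  by rewrite !mxE v0 mulr1.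
exists v => //; split => //.
  by rewrite big_ord_recl v0 gcd1z.
move=> i vi_neq0 vlt0; case: (posnP i) => [i_eq0|i_gt0].
  by rewrite (_ : i = ord0) ?v0 //; apply: val_inj.
by have := vlt0 ord0 i_gt0; rewrite v0.
Qed.

End Bounds.

(** * The extremal graph: disjoint paths and an isolated vertex *)

Section DisjointPaths.

Local Open Scope nat_scope.

(* The path on four vertices 2 - 0 - 1 - 3, with the inner vertices first, so
   that the sign vector starts with 1. *)
Definition path4 (r s : nat) : bool :=
  (r, s) \in [:: (0, 1); (1, 0); (0, 2); (2, 0); (1, 3); (3, 1)].

(** Index [4q + r] is vertex [r] of path [q]; the last index [4k] is alone in its block, hence
    isolated. *)
Definition paths4_adj (i j : nat) : bool :=
  (i %/ 4 == j %/ 4) && path4 (i %% 4) (j %% 4).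

Variable k : nat.

Lemma paths4_sym : symmetric (fun i j : 'I_(4 * k + 1) => paths4_adj i j).
Proof.
move=> i j; rewrite /paths4_adj eq_sym; congr andb.
have := ltn_pmod i (isT : 0 < 4); have := ltn_pmod j (isT : 0 < 4).
by case: (i %% 4) => [|[|[|[|?]]]] //; case: (j %% 4) => [|[|[|[|?]]]].
Qed.

Lemma paths4_irr : irreflexive (fun i j : 'I_(4 * k + 1) => paths4_adj i j).
Proof.
move=> i; rewrite /paths4_adj eqxx /=.
have := ltn_pmod i (isT : 0 < 4).
by case: (i %% 4) => [|[|[|[|?]]]].
Qed.

Definition paths4 : sgraph (4 * k + 1) := SGraph paths4_sym paths4_irr.

Lemma big_blocks4 (V : nmodType) (F : nat -> V) :
  (\sum_(i < 4 * k + 1) F i =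
   \sum_(q < k) \sum_(r < 4) F (4 * q + r)%N + F (4 * k)%N)%R.
Proof.
rewrite -[LHS](big_mkord xpredT) addn1 big_nat_recr //=; congr (_ + _)%R.
elim: k => [|m IHm]; first by rewrite big_geq // big_ord0.
rewrite big_ord_recr /= -IHm mulnSr addn4 !big_nat_recr //=.
by rewrite !big_ord_recr big_ord0 /= !addnS !addn0 add0r !addrA.
Qed.

(** Only the block of [i] contributes. The guard excludes [4k], whose residue 0 would otherwise give
    it the neighbours of an inner vertex. *)
Lemma sum_paths4_adj (V : nmodType) (F : nat -> V) (i : 'I_(4 * k + 1)) :
  (\sum_(j < 4 * k + 1 | adj paths4 i j) F j =
   \sum_(r < 4 | (i < 4 * k)%N && path4 (i %% 4) r) F (4 * (i %/ 4) + r)%N)%R.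
Proof.
rewrite big_mkcond (big_blocks4 (fun j => if paths4_adj i j then F j else 0%R)) /=.
have divE q (r : 'I_4) : (4 * q + r) %/ 4 = q by case: r => r /= ?; lia.
have modE q (r : 'I_4) : (4 * q + r) %% 4 = r by case: r => r /= ?; lia.
have -> : paths4_adj i (4 * k) = false.
  rewrite /paths4_adj mulKn // modnMr; apply/negP => /andP[/eqP ik].
  have -> : i = 4 * k :> nat by case: i ik => i /= ? ?; lia.
  by rewrite modnMr.
rewrite addr0; under eq_bigr do under eq_bigr do rewrite /paths4_adj divE modE.
have [ik|ki] := ltnP i (4 * k); last first.
  rewrite [RHS]big_pred0 //; apply: big1 => q _; apply: big1 => r _.
  by case: eqP => // iq; case: q iq => q /= ? ?; lia.
have qk : i %/ 4 < k by lia.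
rewrite (bigD1 (Ordinal qk)) //= eqxx -big_mkcond /= [X in (_ + X)%R]big1 ?addr0 //.
move=> q; rewrite -val_eqE /= eq_sym => /negPf ->.
by rewrite big1.
Qed.

Lemma card_edges_paths4 : #|edges paths4| = 3 * k.
Proof.
apply/eqP; rewrite -(eqn_pmul2l (isT : 0 < 2)) -sum_card_adj; apply/eqP.
pose d i := \sum_(r < 4 | (i < 4 * k) && path4 (i %% 4) r) 1.
rewrite (eq_bigr (fun i : 'I__ => d i)) => [|i _]; last first.
  by rewrite -sum1_card (sum_paths4_adj (fun=> 1)).
have d_last : d (4 * k) = 0 by rewrite /d ltnn; apply: big_pred0.
rewrite (big_blocks4 d) d_last addr0.
(* The degrees in one path are 2, 2, 1, 1. *)
rewrite (eq_bigr (fun=> 6)) => [|q _].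
  by rewrite sum_nat_const card_ord; lia.
have dE (r : 'I_4) : d (4 * q + r) = \sum_(s < 4 | path4 r s) 1.
  rewrite /d (_ : (4 * q + r) %% 4 = r) 1?(_ : 4 * q + r < 4 * k) //.
    by case: q r => q ? [r] /= ?; lia.
  by case: r => r /= ?; lia.
under eq_bigr do rewrite dE big_mkcond !big_ord_recr big_ord0.
by rewrite !big_ord_recr big_ord0.
Qed.

Lemma paths4_singular_pm1 : singular_pm1 paths4.
Proof.
pose f (i : nat) : int := (if (i %% 4 < 2)%N then 1 else -1)%R.
have k1_gt0 : 0 < 4 * k + 1 by lia.
apply: (@singular_pm1_sign _ _ (\col_i f i)%R (Ordinal k1_gt0)) => //.
- by rewrite mxE.
- by move=> i; rewrite mxE /f; case: ifP; [left|right].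
have fE q (r : 'I_4) : (f (4 * q + r)%N = if (r < 2)%N then 1 else -1)%R.
  rewrite /f (_ : (4 * q + r) %% 4 = r) //; case: r => r /= ?; lia.
apply/matrixP => i j; rewrite ord1 mul_seidelE !mxE.
under eq_bigr do rewrite mxE.
under [X in (2 * X)%R]eq_bigr do rewrite mxE.
(* Each path has sign sum 0, so the total is the 1 at the isolated vertex. *)
rewrite (sum_paths4_adj f) big_blocks4 big1 => [|q _]; last first.
  by under eq_bigr do rewrite fE; rewrite !big_ord_recr big_ord0.
rewrite add0r {1}/f modnMr /=.
under eq_bigr do rewrite fE.
have [ik|ki] := ltnP i (4 * k); last first.
  have -> : i = 4 * k :> nat by case: i ki => i /= ? ?; lia.
  by rewrite big_pred0 //= /f modnMr.
(* The neighbour sum is [1 - 1 = 0] at an inner vertex and 1 at an end, matching [(1 - v_i) / 2]. *)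
rewrite big_mkcond !big_ord_recr big_ord0 /= /f.
have := ltn_pmod i (isT : 0 < 4).
by case: (i %% 4) => [|[|[|[|?]]]].
Qed.

End DisjointPaths.

Theorem theorem5p4 (k : nat) :
  [/\ forall G : sgraph (4 * k + 1), singular_pm1 G ->
        3 * k <= #|edges G| <= 8 * k ^ 2 - k,
      exists2 G : sgraph (4 * k + 1), singular_pm1 G & #|edges G| = 3 * k
    & exists2 G : sgraph (4 * k + 1), singular_pm1 G &
        #|edges G| = 8 * k ^ 2 - k].
Proof.
(* The total is the number of pairs of vertices; removing [3k] from it leaves [8k^2 - k]. *)
have card_compl (G : sgraph (4 * k + 1)) :
    #|edges G| + #|edges (compl G)| = 8 * k ^ 2 + 2 * k.
  have := card_edges_compl G; move: (#|_|) (#|_|) => e e'; nia.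
split.
- move=> G sG; have := edges_ge sG; have := edges_ge (singular_pm1_compl sG).
  have := card_compl G; lia.
- by exists (paths4 k); [exact: paths4_singular_pm1 | exact: card_edges_paths4].
exists (compl (paths4 k)).
  exact/singular_pm1_compl/paths4_singular_pm1.
have := card_compl (paths4 k); rewrite card_edges_paths4; lia.
Qed.
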